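(* Fix $\lambda>0$ and suppose some kernel $P_{Y^*|X}$ attains the infimum $F(\lambda)=\inf_{P_{Y|X}}\{I(X;Y)+\lambda\mathbb E[\mathsf d(X,Y)]\}$, with output distribution $P_{Y^*}$. Let $P_{Y_0}$ satisfy $D(P_{Y^*}\|P_{Y_0})<\infty$ and run the generalized Blahut iteration from $P_{Y_0}$. Then $(F_k(\lambda))_{k\ge1}$ is non-increasing, converges to $F(\lambda)$, and for every $k\ge1$ $$F_k(\lambda)-F(\lambda)\le\frac{D(P_{Y^*}\|P_{Y_0})}{k}.$$
   Context: $X$ has law $P_X$ on a measurable space $\mathcal X$; $\mathsf d\colon\mathcal X\times\mathcal Y\to[0,\infty)$ is a measurable distortion measure (all $\sigma$-algebras containing singletons). Generalized Blahut iteration: given a probability measure $P_{Y_0}$ on $\mathcal Y$, for $k=1,2,\dots$ set $\Sigma_{k-1}(x)=\mathbb E[\exp(-\lambda\mathsf d(x,Y_{k-1}))]$ with $Y_{k-1}\sim P_{Y_{k-1}}$; define the kernel $P_{Y_k|X}$ by $\frac{dP_{Y_k|X=x}}{dP_{Y_{k-1}}}(y)=\frac{\exp(-\lambda\mathsf d(x,y))}{\Sigma_{k-1}(x)}$; this kernel attains $F_k(\lambda)=\min_{P_{Y|X}}\{D(P_{Y|X}\|P_{Y_{k-1}}|P_X)+\lambda\mathbb E[\mathsf d(X,Y)]\}=\mathbb E[\log\frac1{\Sigma_{k-1}(X)}]$; and let $P_{Y_k}$ be the $\mathcal Y$-marginal of $P_XP_{Y_k|X}$. Here $D(P_{Y|X}\|Q|P_X)=\int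 D(P_{Y|X=x}\|Q)\,dP_X(x)$ is conditional relative entropy. Logarithms natural. *)

(* Defs.v *)
From HB Require Import structures.
From mathcomp Require Import all_boot all_order all_algebra.
From mathcomp Require Import all_classical all_reals all_analysis.
Set Implicit Arguments. Unset Strict Implicit. Unset Printing Implicit Defensive.
Import Order.TTheory GRing.Theory Num.Theory.
Import numFieldNormedType.Exports.
Local Open Scope classical_set_scope.
Local Open Scope ring_scope.
Local Open Scope ereal_scope.

(* All "measures" below are handled as set functions [set T -> \bar R];
   integrals [\int[mu]] in MathComp-Analysis are defined for any such set
   function, and every set function to which we apply them is (mathematically)
   a measure. *)

Section info.
Context {R : realType}.

Definition is_density {d} {T : measurableType d}
    (P Q : set T -> \bar R) (f : T -> R) : Prop :=
  [/\ measurable_fun [set: T] f, (forall x, 0 <= f x)%R &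
      forall A, measurable A -> P A = \int[Q]_(x in A) (f x)%:E].

Definition relent {d} {T : measurableType d} (P Q : set T -> \bar R) : \bar R :=
  match pselect (exists f, is_density P Q f) with
  | left h => let f := proj1_sig (cid h) in
              \int[Q]_x ((f x * ln (f x))%R)%:E
  | right _ => +oo
  end.

Context {dx dy : measure_display} {TX : measurableType dx} {TY : measurableType dy}.

Definition condrelent (PX : set TX -> \bar R) (K : R.-pker TX ~> TY)
    (Q : set TY -> \bar R) : \bar R :=
  \int[PX]_x relent (K x) Q.

Definition marginal (PX : set TX -> \bar R) (K : R.-pker TX ~> TY) :
    set TY -> \bar R := fun B => \int[PX]_x K x B.

Definition mutinf (PX : set TX -> \bar R) (K : R.-pker TX ~> TY) : \bar R :=
  condrelent PX K (marginal PX K).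

Definition exp_distortion (PX : set TX -> \bar R) (dist : TX -> TY -> R)
    (K : R.-pker TX ~> TY) : \bar R :=
  \int[PX]_x \int[K x]_y (dist x y)%:E.

Definition RDF (PX : set TX -> \bar R) (dist : TX -> TY -> R) (lam : R) : \bar R :=
  ereal_inf [set mutinf PX K + lam%:E * exp_distortion PX dist K
            | K in [set: R.-pker TX ~> TY]].

Definition Sigma (dist : TX -> TY -> R) (lam : R) (Q : set TY -> \bar R)
    (x : TX) : \bar R :=
  \int[Q]_y (expR (- (lam * dist x y)))%:E.

(* one step of the generalized Blahut iteration: the Y-marginal of P_X P_{Y_k|X}
   where dP_{Y_k|X=x}/dP_{Y_{k-1}}(y) = exp(-lambda d(x,y)) / Sigma_{k-1}(x) *)
Definition blahut_step (PX : set TX -> \bar R) (dist : TX -> TY -> R) (lam : R)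
    (Q : set TY -> \bar R) : set TY -> \bar R :=
  fun B => \int[PX]_x \int[Q]_(y in B)
             (expR (- (lam * dist x y)) / fine (Sigma dist lam Q x))%:E.

Fixpoint blahut (PX : set TX -> \bar R) (dist : TX -> TY -> R) (lam : R)
    (PY0 : set TY -> \bar R) (k : nat) : set TY -> \bar R :=
  match k with
  | O => PY0
  | S k' => blahut_step PX dist lam (blahut PX dist lam PY0 k')
  end.

(* F_k(lambda) = min_{P_{Y|X}} { D(P_{Y|X} || P_{Y_{k-1}} | P_X) + lambda E[d] }
   (meaningful for k >= 1) *)
Definition Fk (PX : set TX -> \bar R) (dist : TX -> TY -> R) (lam : R)
    (PY0 : set TY -> \bar R) (k : nat) : \bar R :=
  ereal_inf [set condrelent PX K (blahut PX dist lam PY0 k.-1)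
                 + lam%:E * exp_distortion PX dist K
            | K in [set: R.-pker TX ~> TY]].

End info.

(* Main.v *)
Require Import Defs.
From HB Require Import structures.
From mathcomp Require Import all_boot all_order all_algebra.
From mathcomp Require Import all_classical all_reals all_analysis.
From mathcomp Require Import measurable_realfun ring lra.
Set Implicit Arguments.
Unset Strict Implicit.
Unset Printing Implicit Defensive.
Import Order.TTheory GRing.Theory Num.Theory.
Local Open Scope classical_set_scope.
Local Open Scope ring_scope.
Local Open Scope ereal_scope.

(** Write Q for the current output law and Q' for the next one, Z(x) for the
    integral of exp(-lambda d(x,y)) dQ(y), and g = ln (dQ'/dQ); e^g is the
    P_X-average of the tilts exp(-lambda d(x,y)) / Z(x), which are the densities
    of the Blahut kernel with respect to Q.

    The Donsker-Varadhan inequality gives F_k = E[-ln Z(X)], attained by the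
    Blahut kernel. By the compensation identity, replacing Q by the marginal Q'
    of that kernel decreases its conditional relative entropy by D(Q'||Q); hence
    F_{k+1} <= F_k and F <= F_k.

    For the rate, take any kernel K with output law P. The Donsker-Varadhan
    inequality for D(K(x)||P) and the test function
    -lambda d(x,y) - ln Z(x) - g(y), averaged over x, reads
    I + lambda E[d] >= F_k - E_P[g], and E_P[g] = D(P||Q) - D(P||Q').
    Telescoping finishes the proof.

    Relative entropies are written as integrals of t ln t - t + 1 >= 0, and g is
    split into its positive and negative parts, so that all integrands are
    nonnegative and no integrability has to be known in advance. *)

Lemma funrposBnegE (T : Type) (R : realDomainType) (f : T -> R) x :
  (f^\+ x - f^\- x = f x)%R.
Proof. by rewrite -[in RHS](funrposBneg f). Qed.

Section integral_complements.
Context d (T : measurableType d) (R : realType).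
Variable mu : {measure set T -> \bar R}.

Lemma ge0_integralD_EFin (f g : T -> R) :
    measurable_fun [set: T] f -> measurable_fun [set: T] g ->
    (forall x, 0 <= f x)%R -> (forall x, 0 <= g x)%R ->
  \int[mu]_x (f x + g x)%:E = \int[mu]_x (f x)%:E + \int[mu]_x (g x)%:E.
Proof.
move=> mf mg f0 g0; rewrite -ge0_integralD//; try exact/measurable_EFinP.
- by move=> x _; rewrite lee_fin.
- by move=> x _; rewrite lee_fin.
Qed.

Lemma ge0_le_integral_EFin (f g : T -> R) :
    measurable_fun [set: T] f -> measurable_fun [set: T] g ->
    (forall x, 0 <= f x)%R -> (forall x, f x <= g x)%R ->
  \int[mu]_x (f x)%:E <= \int[mu]_x (g x)%:E.
Proof.
move=> mf mg f0 fg; apply: ge0_le_integral => //.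
- by move=> x _; rewrite lee_fin.
- exact/measurable_EFinP.
- exact/measurable_EFinP.
- by move=> x _; rewrite lee_fin.
Qed.

Lemma integral_EFin_ge0 (f : T -> R) :
  (forall x, 0 <= f x)%R -> 0 <= \int[mu]_x (f x)%:E.
Proof. by move=> f0; apply: integral_ge0 => x _; rewrite lee_fin. Qed.

Lemma ge0_integralD_integrable (f g : T -> R) :
    measurable_fun [set: T] f -> (forall x, 0 <= f x)%R ->
    mu.-integrable [set: T] (EFin \o g) ->
  \int[mu]_x (f x + g x)%:E = \int[mu]_x (f x)%:E + \int[mu]_x (g x)%:E.
Proof.
move=> mf f0 ig; have /measurable_EFinP mg := measurable_int _ ig.
have [f_lty|] := ltP (\int[mu]_x (f x)%:E) +oo.
  rewrite -integralD_EFin//; apply/integrableP; split.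
    exact/measurable_EFinP.
  by under eq_integral do rewrite /= ger0_norm//.
rewrite leye_eq => /eqP f_oo; pose s x := (f x + g x)%R.
have ms : measurable_fun [set: T] s by exact: measurable_funD.
have mng : measurable_fun [set: T] (fun x => `|g x|)%R.
  exact: measurableT_comp.
have ng_lty : \int[mu]_x (`|g x|)%:E < +oo by have /integrableP[] := ig.
have neg_lty : \int[mu]_x (s^\- x)%R%:E < +oo.
  apply: le_lt_trans ng_lty; apply: ge0_le_integral_EFin => //.
  - exact: measurable_funrneg.
  - move=> x; rewrite /funrneg /s ge_max normr_ge0 andbT.
    by have := f0 x; have := ler_norm (- g x); rewrite normrN; lra.
have pos_oo : \int[mu]_x (s^\+ x)%R%:E = +oo.
  have : +oo <= \int[mu]_x (s^\+ x)%R%:E + \int[mu]_x (`|g x|)%:E.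
    rewrite -f_oo -ge0_integralD_EFin//; last exact: measurable_funrpos.
    apply: ge0_le_integral_EFin => // [|x].
      by apply: measurable_funD => //; exact: measurable_funrpos.
    rewrite /funrpos /s -lerBlDr le_max.
    by have := ler_norm (- g x); rewrite normrN => gN; apply/orP; left; lra.
  move: ng_lty; case: (\int[mu]_x (`|g x|)%:E);
    by case: (\int[mu]_x (s^\+ x)%R%:E).
have /fin_numP[g_neNy _] := integrable_fin_num measurableT ig.
have neg_neNy : - (\int[mu]_x (s^\- x)%R%:E) != -oo.
  by rewrite eqe_oppLR/= lt_eqF.
rewrite f_oo addye// integralE -(addye neg_neNy) -pos_oo; congr (_ - _).
- by apply: eq_integral => x _; rewrite funeposE -EFin_max.
- by apply: eq_integral => x _; rewrite funenegE -EFinN -EFin_max.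
Qed.

End integral_complements.

(* [relent (K x) Q] need not be measurable in [x] when the sigma-algebra of the
   output space is not countably generated.  The integral of a nonnegative
   function is the supremum over the simple functions below it, which is
   monotone, and additive as soon as one of the two summands is measurable. *)
Section lower_integral.
Import HBNNSimple.
Context d (T : measurableType d) (R : realType).
Variable mu : {measure set T -> \bar R}.
Implicit Types f g : T -> \bar R.

Lemma le_lower_integral f g : (forall x, 0 <= f x) -> (forall x, f x <= g x) ->
  \int[mu]_x f x <= \int[mu]_x g x.
Proof.
move=> f0 fg; rewrite !ge0_integralTE//; last first.
  by move=> x; exact: le_trans (fg x).
apply: ge_ereal_sup => _ [s /= sf <-]; apply: ereal_sup_ubound.
by exists s => //= x; exact: le_trans (fg x).
Qed.

Lemma ge_lower_integral f c : (forall x, 0 <= f x) ->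
    (forall h : {nnsfun T >-> R}, (forall x, (h x)%:E <= f x) ->
      \int[mu]_x (h x)%:E <= c) ->
  \int[mu]_x f x <= c.
Proof.
move=> f0 hc; rewrite ge0_integralTE//; apply: ge_ereal_sup => _ [h /= hf <-].
by rewrite -integralT_nnsfun hc.
Qed.

Lemma lower_integralD f g : (forall x, 0 <= f x) -> (forall x, 0 <= g x) ->
    measurable_fun [set: T] g ->
  \int[mu]_x (f x + g x) = \int[mu]_x f x + \int[mu]_x g x.
Proof.
move=> f0 g0 mg; apply/eqP; rewrite eq_le; apply/andP; split.
- apply: ge_lower_integral => [x|h hfg]; first exact: adde_ge0.
  pose u x := maxe ((h x)%:E - g x) 0.
  have u0 x : 0 <= u x by rewrite le_max lexx orbT.
  have measurable_u : measurable_fun [set: T] u.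
    apply: measurable_maxe => //; apply: emeasurable_funB => //.
    exact/measurable_EFinP.
  have uf x : u x <= f x.
    rewrite ge_max f0 andbT; have := g0 x; have := hfg x.
    by case: (g x) => [r|_ _|//]; [rewrite leeBlDr|rewrite /= leNye].
  have hug x : (h x)%:E <= u x + g x.
    have := g0 x; case gx : (g x) => [r| |] //= r0.
      by rewrite -leeBlDr// le_max gx lexx.
    by rewrite addey ?leey// gt_eqF// (lt_le_trans _ (u0 x)).
  apply: (@le_trans _ _ (\int[mu]_x (u x + g x))).
    apply: ge0_le_integral => //; last exact: emeasurable_funD.
    - by move=> x _; rewrite lee_fin.
    - exact/measurable_EFinP.
  by rewrite ge0_integralD// leeD2r// le_lower_integral.
- have [g_lty|] := ltP (\int[mu]_x g x) +oo; last first.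
    rewrite leye_eq => /eqP g_oo; rewrite g_oo (le_trans (leey _))// -g_oo.
    by apply: le_lower_integral => // x; rewrite leeDr.
  have g_fin : \int[mu]_x g x \is a fin_num.
    by rewrite ge0_fin_numE// integral_ge0.
  rewrite -leeBrDr//; apply: ge_lower_integral => // h hf; rewrite leeBrDr//.
  rewrite -ge0_integralD//; last 2 first.
  - by move=> x _; rewrite lee_fin.
  - exact/measurable_EFinP.
  apply: le_lower_integral => x; first by rewrite adde_ge0// lee_fin.
  exact: leeD2r.
Qed.

End lower_integral.

Section density.
Context d (T : measurableType d) (R : realType).
Implicit Types (P Q S : probability T R) (f g : T -> R).

Lemma probability_integral_cst P (r : R) : \int[P]_x r%:E = r%:E.
Proof. by rewrite integral_cst// [X in _ * X]probability_setT mule1. Qed.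

Lemma probability_integral_gt0 P f : measurable_fun [set: T] f ->
  (forall x, 0 < f x)%R -> 0 < \int[P]_x (f x)%:E.
Proof.
move=> mf f0; rewrite lt_neqAle integral_EFin_ge0 ?andbT => [|x]; last first.
  exact: ltW.
apply/eqP => int0.
have mEf : measurable_fun [set: T] (EFin \o f) by exact/measurable_EFinP.
have /(ae_eq_integral_abs P measurableT)[+ _] := mEf.
case.
  by rewrite [RHS]int0; apply: eq_integral => x _; rewrite /= gtr0_norm.
move=> N [mN N0 subN]; have : P [set: T] <= P N.
  rewrite le_measure ?inE// => x _; apply: subN => /= /(_ I) [fx0].
  by have := f0 x; rewrite fx0 ltxx.
by rewrite N0 [X in X <= _]probability_setT lee_fin ler10.
Qed.

Lemma is_density_dominates P Q f : is_density P Q f -> P `<< Q.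
Proof.
move=> [mf f0 PE]; apply/null_content_dominatesP => A mA QA.
rewrite PE//; apply: null_set_integral => //.
by apply: measurable_funTS; exact/measurable_EFinP.
Qed.

Lemma is_density_integral1 P Q f : is_density P Q f -> \int[Q]_x (f x)%:E = 1.
Proof. by case=> _ _ /(_ setT measurableT) <-; exact: probability_setT. Qed.

Lemma is_density_integrable P Q f : is_density P Q f ->
  Q.-integrable [set: T] (EFin \o f).
Proof.
move=> Pf; have [mf f0 _] := Pf; apply/integrableP; split.
  exact/measurable_EFinP.
under eq_integral do rewrite /= ger0_norm//.
by rewrite (is_density_integral1 Pf) ltry.
Qed.

Lemma is_density_ae_eq P Q f g : is_density P Q f -> is_density P Q g ->
  ae_eq Q [set: T] (EFin \o f) (EFin \o g).
Proof.
move=> Pf [mg g0 PgE]; apply: integral_ae_eq => //.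
- exact: is_density_integrable Pf.
- exact/measurable_EFinP.
- by case: Pf => mf f0 PfE A _ mA; rewrite -PfE// -PgE.
Qed.

Lemma is_density_integral P Q f D (g : T -> \bar R) : is_density P Q f ->
    measurable D -> measurable_fun D g -> (forall x, 0 <= g x) ->
  \int[P]_(x in D) g x = \int[Q]_(x in D) (g x * (f x)%:E).
Proof.
move=> Pf mD mg g0; have PQ := is_density_dominates Pf.
rewrite -(Radon_Nikodym_SigmaFinite.change_of_variables PQ)//.
have irn := Radon_Nikodym_SigmaFinite.f_integrable PQ.
have [mf f0 PfE] := Pf; apply: ae_eq_integral => //.
- apply: emeasurable_funM => //; apply: measurable_funTS.
  exact: measurable_int irn.
- apply: emeasurable_funM => //; apply: measurable_funTS.
  exact/measurable_EFinP.
- apply: ae_eqe_mul2l; apply: ae_eq_subset (@subsetT _ D) _.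
  apply: ae_eq_sym; apply: integral_ae_eq => //.
  + exact: is_density_integrable Pf.
  + exact: measurable_int irn.
  + by move=> A _ mA; rewrite -Radon_Nikodym_SigmaFinite.f_integral// -PfE.
Qed.

Lemma is_density_integral_EFin P Q f g : is_density P Q f ->
    measurable_fun [set: T] g -> (forall x, 0 <= g x)%R ->
  \int[P]_x (g x)%:E = \int[Q]_x (g x * f x)%:E.
Proof.
move=> Pf mg g0; rewrite (is_density_integral Pf)//; exact/measurable_EFinP.
Qed.

Lemma is_density_refl P : is_density P P (fun=> 1%R).
Proof. by split=> // A mA; rewrite integral_cst// mul1e. Qed.

Lemma is_density_trans P Q S f g : is_density P Q f -> is_density Q S g ->
  is_density P S (fun x => f x * g x)%R.
Proof.
move=> [mf f0 PE] Qg; have [mg g0 _] := Qg.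
split; [exact: measurable_funM|by move=> x; rewrite mulr_ge0|move=> A mA].
rewrite PE// (is_density_integral Qg)//.
by apply: measurable_funTS; exact/measurable_EFinP.
Qed.

Lemma is_density_expRN P Q g : measurable_fun [set: T] g ->
  is_density P Q (expR \o g) -> is_density Q P (fun x => expR (- g x)).
Proof.
move=> mg Pg.
have mNg : measurable_fun [set: T] (fun x => expR (- g x)).
  by apply: measurableT_comp => //; exact: measurableT_comp.
split=> [//|x|A mA]; first exact: expR_ge0.
rewrite (is_density_integral Pg)//; last first.
  exact/measurable_funTS/measurable_EFinP.
rewrite (eq_integral (cst 1)) => [|x _]; first by rewrite integral_cst// mul1e.
by rewrite -EFinM /= -expRD addNr expR0.
Qed.

(* [ln] and [fine] send the points where [c] is infinite to [0]; these form a
   null set. *)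
Lemma exists_log_density P Q (c : T -> \bar R) :
    measurable_fun [set: T] c -> (forall x, 0 < c x) ->
    (forall A, measurable A -> P A = \int[Q]_(x in A) c x) ->
  exists g : T -> R, [/\ measurable_fun [set: T] g, is_density P Q (expR \o g) &
    {ae Q, forall x, c x = (expR (g x))%:E}].
Proof.
move=> mc c_gt0 PE; have c_ge0 x : 0 <= c x by exact: ltW.
pose g x := ln (fine (c x)).
have mg : measurable_fun [set: T] g.
  apply: measurableT_comp (@measurable_ln R) _.
  exact: measurableT_comp.
have cg : {ae Q, forall x, c x = (expR (g x))%:E}.
  have : Q.-integrable [set: T] c.
    apply/integrableP; split => //.
    under eq_integral do rewrite gee0_abs//.
    by rewrite -PE// [X in X < _]probability_setT ltry.
  move=> /(integrable_ae measurableT); apply: filterS => x /(_ I) cfin.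
  by rewrite /g lnK ?fineK// posrE fine_gt0// c_gt0 ltey_eq cfin.
have meg : measurable_fun [set: T] (expR \o g) by exact: measurableT_comp.
exists g; split => //; split => // [x|A mA]; first exact: expR_ge0.
rewrite PE//; apply: ae_eq_integral => //.
- exact: measurable_funTS.
- exact/measurable_funTS/measurable_EFinP.
- by apply: filterS cg => x ->.
Qed.

End density.

Section relative_entropy.
Context d (T : measurableType d) (R : realType).
Implicit Types (P Q : probability T R) (f g a b : T -> R).

Definition kl_generator (t : R) : R := (t * ln t - t + 1)%R.

(* [expR v - 1] is the convex conjugate of [kl_generator]. *)
Lemma kl_generator_young (t v : R) : (0 <= t)%R ->
  (t * v <= kl_generator t + (expR v - 1))%R.
Proof.
rewrite /kl_generator le_eqVlt => /predU1P[<-|t0].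
  by have := expR_ge0 v; rewrite !mul0r; lra.
have := expR_ge1Dx (v - ln t); rewrite expRD expRN lnK ?posrE//.
by rewrite ler_pdivlMr//; lra.
Qed.

Lemma kl_generator_ge0 t : (0 <= t)%R -> (0 <= kl_generator t)%R.
Proof.
by move=> t0; have := kl_generator_young 0 t0; rewrite mulr0 expR0 subrr addr0.
Qed.

Lemma measurable_kl_generator f : measurable_fun [set: T] f ->
  measurable_fun [set: T] (fun x => kl_generator (f x)).
Proof.
move=> mf; apply: measurable_funD => //; apply: measurable_funB => //.
by apply: measurable_funM => //; exact: measurableT_comp (@measurable_ln R) mf.
Qed.

Lemma relentE P Q f : is_density P Q f ->
  relent P Q = \int[Q]_x (kl_generator (f x))%:E.
Proof.
move=> Pf; rewrite /relent; case: pselect => [h|]; last by case; exists f.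
case: cid => g Pg /=; have [mf f0 _] := Pf; have [mg g0 _] := Pg.
have f_int := is_density_integrable Pf.
have one_int := is_density_integrable (is_density_refl Q).
have fB1_int : Q.-integrable [set: T] (EFin \o (fun x => f x - 1)%R).
  exact: integrableB f_int one_int.
have integral_fB1 : \int[Q]_x (f x - 1)%:E = 0.
  rewrite integralB_EFin// (is_density_integral1 Pf).
  by rewrite probability_integral_cst subee.
rewrite -[RHS]adde0 -integral_fB1 -ge0_integralD_integrable//; last 2 first.
- exact: measurable_kl_generator.
- by move=> x; exact: kl_generator_ge0.
apply: ae_eq_integral => //.
- apply/measurable_EFinP; apply: measurable_funM => //.
  exact: measurableT_comp (@measurable_ln R) mg.
- apply/measurable_EFinP; apply: measurable_funD.
    exact: measurable_kl_generator.
  exact: measurable_funB.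
have := is_density_ae_eq Pg Pf; apply: filterS => x /= /(_ I) [->] _.
by congr (_%:E); rewrite /kl_generator; lra.
Qed.

Lemma relent_lty_density P Q : relent P Q < +oo -> exists f, is_density P Q f.
Proof. by rewrite /relent; case: pselect. Qed.

Lemma relent_nodensity P Q : ~ (exists f, is_density P Q f) -> relent P Q = +oo.
Proof. by rewrite /relent; case: pselect. Qed.

Lemma relent_ge0 P Q : 0 <= relent P Q.
Proof.
have [[f Pf]|/relent_nodensity->//] := pselect (exists f, is_density P Q f).
rewrite (relentE Pf); apply: integral_EFin_ge0 => x; apply: kl_generator_ge0.
by case: Pf.
Qed.

Lemma relent_refl P : relent P P = 0.
Proof.
rewrite (relentE (is_density_refl P)); apply: integral0_eq => x _.
by rewrite /kl_generator ln1 mulr0 sub0r addNr.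
Qed.

(* The Donsker-Varadhan inequality for the test function [b - a], with [ln t]
   replaced by [t - 1] and every term moved to where it is nonnegative, so that
   nothing has to be integrable. *)
Lemma donsker_varadhan P Q a b :
    measurable_fun [set: T] a -> measurable_fun [set: T] b ->
    (forall x, 0 <= a x)%R -> (forall x, 0 <= b x)%R ->
  \int[P]_x (b x)%:E + 1 <=
    relent P Q + (\int[Q]_x (expR (b x - a x))%:E + \int[P]_x (a x)%:E).
Proof.
move=> ma mb a0 b0.
have me : measurable_fun [set: T] (fun x => expR (b x - a x)).
  by apply: measurableT_comp => //; exact: measurable_funB.
have [[f Pf]|/relent_nodensity->] := pselect (exists f, is_density P Q f);
  last first.
  rewrite addye ?leey// gt_eqF// (@lt_le_trans _ _ 0)// adde_ge0//.
    by apply: integral_EFin_ge0 => x; exact: expR_ge0.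
  exact: integral_EFin_ge0.
have [mf f0 _] := Pf.
rewrite (relentE Pf) !(is_density_integral_EFin Pf)//.
rewrite -[X in _ + X <= _](probability_integral_cst Q 1).
have maf : measurable_fun [set: T] (fun x => a x * f x)%R.
  exact: measurable_funM.
have mbf : measurable_fun [set: T] (fun x => b x * f x)%R.
  exact: measurable_funM.
have mkl := measurable_kl_generator mf.
have kl0 x : (0 <= kl_generator (f x))%R by exact: kl_generator_ge0.
have af0 x : (0 <= a x * f x)%R by rewrite mulr_ge0.
have bf0 x : (0 <= b x * f x)%R by rewrite mulr_ge0.
have eaf0 x : (0 <= expR (b x - a x) + a x * f x)%R.
  by rewrite addr_ge0// expR_ge0.
rewrite -!ge0_integralD_EFin//; last exact: measurable_funD.
apply: ge0_le_integral_EFin => [|||x].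
- exact: measurable_funD.
- by apply: measurable_funD => //; exact: measurable_funD.
- by move=> x; rewrite addr_ge0.
- by have := kl_generator_young (b x - a x) (f0 x); lra.
Qed.

Section chain_rule.
Variables (P Q Q' : probability T R) (a b : T -> R).
Hypotheses (ma : measurable_fun [set: T] a) (mb : measurable_fun [set: T] b).
Hypotheses (a_ge0 : forall x, (0 <= a x)%R) (b_ge0 : forall x, (0 <= b x)%R).
Hypothesis Q'Q : is_density Q' Q (fun x => expR (b x - a x)).

Let relent_chain_rule_density f : is_density P Q' f ->
  relent P Q' + \int[P]_x (b x)%:E = relent P Q + \int[P]_x (a x)%:E.
Proof.
move=> Pf; pose c x : R := expR (b x - a x).
have Pfc := is_density_trans Pf Q'Q; have [mf f0 _] := Pf.
have mc : measurable_fun [set: T] c by case: Q'Q.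
have c0 x : (0 <= c x)%R by exact: expR_ge0.
have mfc : measurable_fun [set: T] (fun x => f x * c x)%R.
  exact: measurable_funM.
have fc0 x : (0 <= f x * c x)%R by rewrite mulr_ge0.
have mkl := measurable_kl_generator mf.
have mklfc := measurable_kl_generator mfc.
have kl0 x : (0 <= kl_generator (f x))%R by exact: kl_generator_ge0.
have klfc0 x : (0 <= kl_generator (f x * c x))%R by exact: kl_generator_ge0.
rewrite (relentE Pf) (relentE Pfc) !(is_density_integral_EFin Pfc)//.
rewrite (is_density_integral_EFin Q'Q)//.
rewrite -[LHS](@addeK R 1)// -[RHS](@addeK R 1)//; congr (_ - _).
rewrite -[X in _ + X = _](probability_integral_cst Q 1).
rewrite -[X in _ = _ + X](is_density_integral1 Q'Q).
have mklf : measurable_fun [set: T] (fun x => kl_generator (f x) * c x)%R.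
  exact: measurable_funM.
have maf : measurable_fun [set: T] (fun x => a x * (f x * c x))%R.
  exact: measurable_funM.
have mbf : measurable_fun [set: T] (fun x => b x * (f x * c x))%R.
  exact: measurable_funM.
have klf0 x : (0 <= kl_generator (f x) * c x)%R by rewrite mulr_ge0.
have af0 x : (0 <= a x * (f x * c x))%R by rewrite mulr_ge0.
have bf0 x : (0 <= b x * (f x * c x))%R by rewrite mulr_ge0.
rewrite -!ge0_integralD_EFin//.
- apply: eq_integral => x _; congr (_%:E); rewrite /kl_generator.
  have := f0 x; rewrite le_eqVlt => /predU1P[<-|fx].
    by rewrite !(mul0r, mulr0, subr0, add0r) mul1r; lra.
  by rewrite lnM ?posrE ?expR_gt0// expRK; ring.
- exact: measurable_funD.
- by move=> x; rewrite addr_ge0.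
- exact: measurable_funD.
- by move=> x; rewrite addr_ge0.
Qed.

(* [D(P || Q') = D(P || Q) - E_P(b - a)], where each term may be infinite. *)
Lemma relent_chain_rule :
  relent P Q' + \int[P]_x (b x)%:E = relent P Q + \int[P]_x (a x)%:E.
Proof.
have [[f Pf]|nPQ'] := pselect (exists f, is_density P Q' f).
  exact: relent_chain_rule_density Pf.
have nPQ : ~ (exists f, is_density P Q f).
  have QQ' := is_density_expRN (measurable_funB mb ma) Q'Q.
  by move=> [f Pf]; apply: nPQ'; eexists; exact: is_density_trans Pf QQ'.
rewrite !relent_nodensity// !addye// -ltNye (@lt_le_trans _ _ 0)//;
  exact: integral_EFin_ge0.
Qed.

End chain_rule.

Lemma integral_log_density_pos_le P Q Q' g : measurable_fun [set: T] g ->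
    is_density Q' Q (expR \o g) ->
  \int[P]_x (g^\+ x)%R%:E <= relent P Q + 1.
Proof.
move=> mg Q'Q; rewrite -(@leeD2rE _ 1)// -[leRHS]addeA.
have := @donsker_varadhan P Q (fun=> 0%R) g^\+%R (measurable_cst _)
  (measurable_funrpos mg) (fun=> lexx _) (funrpos_ge0 g).
move=> /le_trans; apply; rewrite probability_integral_cst adde0 leeD2l//.
rewrite -[X in _ <= X + _](is_density_integral1 Q'Q).
rewrite -[X in _ <= _ + X](probability_integral_cst Q 1).
have meg : measurable_fun [set: T] (expR \o g) by exact: measurableT_comp.
rewrite -ge0_integralD_EFin//; last by move=> x; exact: expR_ge0.
apply: ge0_le_integral_EFin => [|||x].
- apply: measurableT_comp => //; apply: measurable_funB => //.
  exact: measurable_funrpos.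
- exact: measurable_funD.
- by move=> x; exact: expR_ge0.
- rewrite subr0 /funrpos; case: (leP (g x) 0%R) => _; rewrite /= ?expR0.
    by rewrite lerDr expR_ge0.
  by rewrite lerDl.
Qed.

Lemma integral_log_density_neg_le P Q g : measurable_fun [set: T] g ->
    is_density P Q (expR \o g) ->
  \int[P]_x (g^\- x)%R%:E <= 1.
Proof.
move=> mg PQ; have mNg : measurable_fun [set: T] (\- g)%R.
  exact: measurableT_comp.
have := integral_log_density_pos_le P mNg (is_density_expRN mg PQ).
by rewrite relent_refl add0e funrposN.
Qed.

Lemma relent_chain_rule_log_density P Q Q' g : measurable_fun [set: T] g ->
    is_density Q' Q (expR \o g) ->
  relent P Q' + \int[P]_x (g^\+ x)%R%:E = relent P Q + \int[P]_x (g^\- x)%R%:E.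
Proof.
move=> mg Q'Q; apply: relent_chain_rule.
- exact: measurable_funrneg.
- exact: measurable_funrpos.
- exact: funrneg_ge0.
- exact: funrpos_ge0.
- by under eq_fun do rewrite funrposBnegE.
Qed.

End relative_entropy.

Section kernel_laws.
Context (R : realType) d (T : measurableType d) d' (T' : measurableType d').

(* [K x] has no canonical [probability] structure; this copy of it does. *)
Definition pker_law (K : R.-pker T ~> T') (x : T) : set T' -> \bar R := K x.

HB.instance Definition _ K x := isMeasure.Build d' T' R (pker_law K x)
  (measure0 (K x)) (measure_ge0 (K x))
  (@measure_semi_sigma_additive _ _ _ (K x)).

HB.instance Definition _ K x :=
  Measure_isProbability.Build d' T' R (pker_law K x) (prob_kernel x).

Section marginal.
Variables (PX : probability T R) (K : R.-pker T ~> T').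

Let PX_kernel : R.-pker unit ~> T :=
  kprobability (@measurable_cst _ _ unit _ setT (PX : pprobability T R)).

Let marginal_measure : {measure set T' -> \bar R} :=
  mkcomp PX_kernel (kernel.kernel_snd (T0 := unit) K) tt.

Let marginal_setT : marginal PX K setT = 1.
Proof.
rewrite /marginal; under eq_integral do rewrite prob_kernel.
exact: probability_integral_cst.
Qed.

HB.instance Definition _ := isMeasure.Build d' T' R (marginal PX K)
  (measure0 marginal_measure) (measure_ge0 marginal_measure)
  (@measure_semi_sigma_additive _ _ _ marginal_measure).

HB.instance Definition _ :=
  Measure_isProbability.Build d' T' R (marginal PX K) marginal_setT.

Lemma integral_marginal (g : T' -> \bar R) : (forall y, 0 <= g y) ->
    measurable_fun [set: T'] g ->
  \int[marginal PX K]_y g y = \int[PX]_x \int[K x]_y g y.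
Proof.
exact: (integral_kcomp PX_kernel (kernel.kernel_snd (T0 := unit) K) tt).
Qed.

End marginal.

Section density_kernel.
Variables (Q : probability T' R) (f : T -> T' -> R).
Hypothesis mf : measurable_fun [set: T * T'] (fun p => f p.1 p.2).
Hypothesis f_ge0 : forall x y, (0 <= f x y)%R.
Hypothesis int_f : forall x, \int[Q]_y (f x y)%:E = 1.

Let measurable_section x : measurable_fun [set: T'] (f x).
Proof. exact: (measurable_fun_pair2 x mf). Qed.

Let density_law (x : T) (B : set T') : \bar R :=
  \int[Q]_(y in B) (f x y)%:E.

Let density_law0 x : density_law x set0 = 0.
Proof. exact: integral_set0. Qed.

Let density_law_ge0 x B : 0 <= density_law x B.
Proof. by apply: integral_ge0 => y _; rewrite lee_fin. Qed.

Let density_law_sigma_additive x : semi_sigma_additive (density_law x).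
Proof.
apply: semi_sigma_additive_nng_induced => [|y].
  exact/measurable_EFinP/measurable_section.
by rewrite lee_fin.
Qed.

HB.instance Definition _ x := isMeasure.Build d' T' R (density_law x)
  (density_law0 x) (density_law_ge0 x) (@density_law_sigma_additive x).

Definition density_kernel (x : T) : {measure set T' -> \bar R} := density_law x.

Let f_indic (B : set T') (p : T * T') : \bar R := (f p.1 p.2 * \1_B p.2)%:E.

Let density_kernelE x B :
  density_kernel x B = \int[Q]_y f_indic B (x, y).
Proof.
rewrite /density_kernel /= /density_law integral_mkcond.
apply: eq_integral => y _.
by rewrite patchE /f_indic indicE; case: ifPn => _ /=; rewrite ?mulr1 ?mulr0.
Qed.

Let measurable_f_indic B : measurable B ->
  measurable_fun [set: T * T'] (f_indic B).
Proof.
move=> mB; apply/measurable_EFinP/measurable_funM => //.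
exact: (measurableT_comp (measurable_indic mB)).
Qed.

Let f_indic_ge0 B p : 0 <= f_indic B p.
Proof. by rewrite lee_fin mulr_ge0. Qed.

Let measurable_density_kernel B : measurable B ->
  measurable_fun [set: T] (density_kernel ^~ B).
Proof.
move=> mB; rewrite (_ : _ ^~ _ = fubini_F Q (f_indic B)).
  apply: measurable_fun_fubini_tonelli_F => //; exact: measurable_f_indic.
by apply/funext => x; exact: density_kernelE.
Qed.

HB.instance Definition _ :=
  isKernel.Build d d' T T' R density_kernel measurable_density_kernel.

HB.instance Definition _ :=
  Kernel_isProbability.Build d d' T T' R density_kernel int_f.

Definition density_pker : R.-pker T ~> T' := density_kernel.

Lemma is_density_density_pker x : is_density (density_pker x) Q (f x).
Proof. by []. Qed.

Lemma marginal_density_pker (PX : probability T R) B : measurable B ->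
  marginal PX density_pker B = \int[Q]_(y in B) \int[PX]_x (f x y)%:E.
Proof.
move=> mB; rewrite /marginal; under eq_integral do rewrite density_kernelE.
have mfB := measurable_f_indic mB.
rewrite (@fubini_tonelli _ _ _ _ _ PX Q _ mfB (f_indic_ge0 B)).
rewrite [RHS]integral_mkcond; apply: eq_integral => y _.
rewrite patchE /f_indic; case: ifPn => yB.
  by apply: eq_integral => x _; rewrite indicE yB mulr1.
by apply: integral0_eq => x _; rewrite indicE (negbTE yB) mulr0.
Qed.

End density_kernel.
End kernel_laws.

Section joint_expectation.
Context (R : realType) d (T : measurableType d) d' (T' : measurableType d').
Variable PX : probability T R.
Implicit Types (K : R.-pker T ~> T') (a b f g : T -> T' -> R).

Definition joint_expectation (K : T -> {measure set T' -> \bar R}) f : \bar R :=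
  \int[PX]_x \int[K x]_y (f x y)%:E.

Lemma measurable_pker_integral K f :
    measurable_fun [set: T * T'] (fun p => f p.1 p.2) ->
    (forall x y, 0 <= f x y)%R ->
  measurable_fun [set: T] (fun x => \int[K x]_y (f x y)%:E).
Proof.
move=> mf f0.
apply: (measurable_fun_integral_finite_kernel (fun p => (f p.1 p.2)%:E) K).
- by move=> p; rewrite lee_fin.
- exact/measurable_EFinP.
Qed.

Lemma joint_expectation_ge0 K f :
  (forall x y, 0 <= f x y)%R -> 0 <= joint_expectation K f.
Proof. by move=> f0; apply: integral_ge0 => x _; exact: integral_EFin_ge0. Qed.

Lemma joint_expectationD K f g :
    measurable_fun [set: T * T'] (fun p => f p.1 p.2) ->
    measurable_fun [set: T * T'] (fun p => g p.1 p.2) ->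
    (forall x y, 0 <= f x y)%R -> (forall x y, 0 <= g x y)%R ->
  joint_expectation K (fun x y => f x y + g x y)%R =
  joint_expectation K f + joint_expectation K g.
Proof.
move=> mf mg f0 g0; rewrite /joint_expectation -ge0_integralD//; last 4 first.
- by move=> x _; exact: integral_EFin_ge0.
- exact: measurable_pker_integral.
- by move=> x _; exact: integral_EFin_ge0.
- exact: measurable_pker_integral.
apply: eq_integral => x _; rewrite ge0_integralD_EFin//.
- exact: (measurable_fun_pair2 x mf).
- exact: (measurable_fun_pair2 x mg).
Qed.

Lemma joint_expectationZ K f (r : R) :
    measurable_fun [set: T * T'] (fun p => f p.1 p.2) ->
    (forall x y, 0 <= f x y)%R -> (0 <= r)%R ->
  joint_expectation K (fun x y => r * f x y)%R = r%:E * joint_expectation K f.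
Proof.
move=> mf f0 r0; rewrite /joint_expectation -ge0_integralZl//; last 2 first.
- exact: measurable_pker_integral.
- by move=> x _; exact: integral_EFin_ge0.
apply: eq_integral => x _; rewrite -ge0_integralZl//.
- by apply/measurable_EFinP; exact: (measurable_fun_pair2 x mf).
- by move=> y _; rewrite lee_fin.
Qed.

Lemma joint_expectation_fst K (u : T -> R) :
  joint_expectation K (fun x _ => u x) = \int[PX]_x (u x)%:E.
Proof.
by apply: eq_integral => x _; exact: (probability_integral_cst (pker_law K x)).
Qed.

Lemma joint_expectation_snd K (v : T' -> R) :
    measurable_fun [set: T'] v -> (forall y, 0 <= v y)%R ->
  joint_expectation K (fun _ y => v y) = \int[marginal PX K]_y (v y)%:E.
Proof.
by move=> mv v0; rewrite integral_marginal//; exact/measurable_EFinP.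
Qed.

Lemma condrelent_ge0 K (Q : probability T' R) : 0 <= condrelent PX K Q.
Proof. by apply: integral_ge0 => x _; exact: (relent_ge0 (pker_law K x)). Qed.

Lemma conditional_donsker_varadhan K (Q : probability T' R) a b :
    measurable_fun [set: T * T'] (fun p => a p.1 p.2) ->
    measurable_fun [set: T * T'] (fun p => b p.1 p.2) ->
    (forall x y, 0 <= a x y)%R -> (forall x y, 0 <= b x y)%R ->
  joint_expectation K b + 1 <= condrelent PX K Q +
    (joint_expectation (fun=> Q) (fun x y => expR (b x y - a x y)) +
     joint_expectation K a).
Proof.
move=> ma mb a0 b0; rewrite -[X in _ + X <= _](probability_integral_cst PX 1).
have me : measurable_fun [set: T * T'] (fun p => expR (b p.1 p.2 - a p.1 p.2)).
  by apply: measurableT_comp => //; exact: measurable_funB.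
have mQe :
    measurable_fun [set: T] (fun x => \int[Q]_y (expR (b x y - a x y))%:E).
  apply: (@measurable_fun_fubini_tonelli_F _ _ _ _ _ Q
    (fun p => (expR (b p.1 p.2 - a p.1 p.2))%:E)).
  - exact/measurable_EFinP.
  - by move=> p; rewrite lee_fin expR_ge0.
have e0 x : 0 <= \int[Q]_y (expR (b x y - a x y))%:E.
  by apply: integral_EFin_ge0 => y; exact: expR_ge0.
have ka0 x : 0 <= \int[K x]_y (a x y)%:E by exact: integral_EFin_ge0.
have kb0 x : 0 <= \int[K x]_y (b x y)%:E by exact: integral_EFin_ge0.
have mKa := measurable_pker_integral K ma a0.
rewrite -ge0_integralD//; last exact: measurable_pker_integral.
rewrite -[X in _ <= _ + X]ge0_integralD// -lower_integralD; last 3 first.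
- by move=> x; exact: (relent_ge0 (pker_law K x)).
- by move=> x; rewrite adde_ge0.
- exact: emeasurable_funD.
apply: le_lower_integral => x; first by rewrite adde_ge0.
apply: (donsker_varadhan (pker_law K x)) => //.
- exact: (measurable_fun_pair2 x ma).
- exact: (measurable_fun_pair2 x mb).
Qed.

Lemma joint_expectation_density_ratio (P Q : probability T' R) f
    (g h : T' -> R) :
    measurable_fun [set: T * T'] (fun p => f p.1 p.2) ->
    (forall x y, 0 <= f x y)%R -> measurable_fun [set: T'] g ->
    is_density P Q h ->
    {ae Q, forall y, \int[PX]_x (f x y)%:E = (expR (g y))%:E} ->
  joint_expectation (fun=> P) (fun x y => f x y * expR (- g y))%R = 1.
Proof.
move=> mf f0 mg Ph fg; have [mh h0 _] := Ph.
pose r (p : T * T') := (f p.1 p.2 * expR (- g p.2))%:E.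
have mr : measurable_fun [set: T * T'] r.
  apply/measurable_EFinP/measurable_funM => //; apply: measurableT_comp => //.
  by apply: measurableT_comp => //; exact: measurableT_comp.
have r0 p : 0 <= r p by rewrite lee_fin mulr_ge0// expR_ge0.
have mGr := @measurable_fun_fubini_tonelli_G _ _ _ _ _ PX r mr r0.
rewrite /joint_expectation (@fubini_tonelli _ _ _ _ _ PX P r mr r0).
rewrite (is_density_integral Ph)//; last by move=> y; exact: integral_ge0.
rewrite -(is_density_integral1 Ph); apply: ae_eq_integral => //.
- by apply: emeasurable_funM => //; exact/measurable_EFinP.
- exact/measurable_EFinP.
- apply: filterS fg => y fgy _ /=; rewrite /r /=.
  under eq_integral do rewrite EFinM.
  rewrite ge0_integralZr//.
  + by rewrite fgy -EFinM -expRD subrr expR0 mul1r.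
  + by apply/measurable_EFinP; exact: (measurable_fun_pair1 y mf).
  + by move=> x _; rewrite lee_fin.
Qed.

Lemma compensation_identity K (Q : probability T' R) (g : T' -> R) :
    measurable_fun [set: T'] g -> is_density (marginal PX K) Q (expR \o g) ->
  condrelent PX K Q = mutinf PX K + relent (marginal PX K) Q.
Proof.
move=> mg Q'Q.
have mgp := measurable_funrpos mg; have mgn := measurable_funrneg mg.
have mKp := measurable_pker_integral K (measurableT_comp mgp measurable_snd)
  (fun _ => funrpos_ge0 g).
have mKn := measurable_pker_integral K (measurableT_comp mgn measurable_snd)
  (fun _ => funrneg_ge0 g).
have gn_fin : \int[marginal PX K]_y (g^\- y)%R%:E \is a fin_num.
  rewrite ge0_fin_numE ?integral_EFin_ge0//.
  exact: le_lt_trans (integral_log_density_neg_le mg Q'Q) (ltry _).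
have mutinf_chain : mutinf PX K + \int[marginal PX K]_y (g^\+ y)%R%:E =
    condrelent PX K Q + \int[marginal PX K]_y (g^\- y)%R%:E.
  rewrite -(joint_expectation_snd K mgp (funrpos_ge0 g)).
  rewrite -(joint_expectation_snd K mgn (funrneg_ge0 g)).
  have relentK_ge0 (P : probability T' R) x : 0 <= relent (K x) P.
    exact: (relent_ge0 (pker_law K x)).
  have gp0 x : 0 <= \int[K x]_y (g^\+ y)%R%:E by exact: integral_EFin_ge0.
  have gn0 x : 0 <= \int[K x]_y (g^\- y)%R%:E by exact: integral_EFin_ge0.
  rewrite /mutinf /condrelent /joint_expectation.
  rewrite -(lower_integralD PX (relentK_ge0 Q) gn0 mKn).
  rewrite -(lower_integralD PX (relentK_ge0 (marginal PX K)) gp0 mKp).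
  apply: eq_integral => x _.
  exact: (relent_chain_rule_log_density (pker_law K x) mg Q'Q).
have := relent_chain_rule_log_density (marginal PX K) mg Q'Q.
rewrite relent_refl add0e => marginal_chain.
rewrite -[LHS](@addeK _ (\int[marginal PX K]_y (g^\- y)%R%:E))//.
by rewrite -mutinf_chain marginal_chain addeA addeK.
Qed.

End joint_expectation.

Section blahut_single_step.
Context (R : realType) (dx dy : measure_display).
Context (TX : measurableType dx) (TY : measurableType dy).
Variables (PX : probability TX R) (dist : TX -> TY -> R) (lam : R).
Hypothesis mdist : measurable_fun [set: TX * TY] (fun p => dist p.1 p.2).
Hypothesis dist_ge0 : forall x y, (0 <= dist x y)%R.
Hypothesis lam_ge0 : (0 <= lam)%R.
Implicit Type K : R.-pker TX ~> TY.

Local Notation energy x y := (lam * dist x y)%R.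

Let energy_ge0 x y : (0 <= energy x y)%R. Proof. exact: mulr_ge0. Qed.

Let measurable_energy : measurable_fun [set: TX * TY] (fun p => energy p.1 p.2).
Proof. exact: measurable_funM. Qed.

Let measurable_boltzmann :
  measurable_fun [set: TX * TY] (fun p => expR (- energy p.1 p.2)).
Proof. by apply: measurableT_comp => //; exact: measurableT_comp. Qed.

Definition lagrangian (Q : set TY -> \bar R) K : \bar R :=
  condrelent PX K Q + lam%:E * exp_distortion PX dist K.

Lemma lagrangianE Q K :
  lagrangian Q K =
  condrelent PX K Q + joint_expectation PX K (fun x y => energy x y).
Proof. by rewrite joint_expectationZ. Qed.

Lemma lagrangian_ge0 (Q : probability TY R) K : 0 <= lagrangian Q K.
Proof.
by rewrite lagrangianE adde_ge0 ?condrelent_ge0 ?joint_expectation_ge0.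
Qed.

Section partition_function.
Variable Q : probability TY R.

Definition partfun (x : TX) : R := fine (Sigma dist lam Q x).
Local Notation Z := partfun.

Lemma Sigma_le1 x : Sigma dist lam Q x <= 1.
Proof.
rewrite -[leRHS](probability_integral_cst Q 1).
apply: ge0_le_integral_EFin => //.
- exact: (measurable_fun_pair2 x measurable_boltzmann).
- by move=> y; rewrite expR_le1 oppr_le0.
Qed.

Lemma Sigma_gt0 x : 0 < Sigma dist lam Q x.
Proof.
apply: probability_integral_gt0 => [|y]; last exact: expR_gt0.
exact: (measurable_fun_pair2 x measurable_boltzmann).
Qed.

Lemma partfunE x : Sigma dist lam Q x = (Z x)%:E.
Proof.
rewrite /partfun fineK// ge0_fin_numE ?ltW ?Sigma_gt0//.
exact: le_lt_trans (Sigma_le1 x) (ltry _).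
Qed.

Lemma partfun_gt0 x : (0 < Z x)%R.
Proof. by rewrite -lte_fin -partfunE Sigma_gt0. Qed.

Lemma oppr_ln_partfun_ge0 x : (0 <= - ln (Z x))%R.
Proof. by rewrite oppr_ge0 ln_le0// -lee_fin -partfunE Sigma_le1. Qed.

Lemma measurable_partfun : measurable_fun [set: TX] Z.
Proof.
apply: measurableT_comp => //.
apply: (@measurable_fun_fubini_tonelli_F _ _ _ _ _ Q
  (fun p => (expR (- energy p.1 p.2))%:E)).
- exact/measurable_EFinP.
- by move=> p; rewrite lee_fin expR_ge0.
Qed.

Lemma measurable_oppr_ln_partfun :
  measurable_fun [set: TX] (fun x => - ln (Z x))%R.
Proof.
apply: measurableT_comp => //.
exact: measurableT_comp (@measurable_ln R) measurable_partfun.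
Qed.

Definition tilt x y : R := (expR (- energy x y) / Z x)%R.

Lemma tiltE x y : tilt x y = expR (- ln (Z x) - energy x y).
Proof. by rewrite addrC expRD (expRN (ln _)) lnK ?posrE ?partfun_gt0. Qed.

Lemma tilt_ge0 x y : (0 <= tilt x y)%R.
Proof. by rewrite tiltE expR_ge0. Qed.

Lemma measurable_tilt : measurable_fun [set: TX * TY] (fun p => tilt p.1 p.2).
Proof.
under eq_fun do rewrite tiltE; apply: measurableT_comp => //.
apply: measurable_funB => //.
exact: (measurableT_comp measurable_oppr_ln_partfun measurable_fst).
Qed.

Lemma integral_tilt x : \int[Q]_y (tilt x y)%:E = 1.
Proof.
under eq_integral do rewrite /tilt mulrC EFinM.
rewrite ge0_integralZl//.
- rewrite -/(Sigma dist lam Q x) partfunE -EFinM mulVf// gt_eqF//.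
  exact: partfun_gt0.
- apply/measurable_EFinP.
  exact: (measurable_fun_pair2 x measurable_boltzmann).
- by rewrite lee_fin invr_ge0 ltW// partfun_gt0.
Qed.

Definition blahut_kernel : R.-pker TX ~> TY :=
  density_pker measurable_tilt tilt_ge0 integral_tilt.

Lemma marginal_blahut_kernel :
  marginal PX blahut_kernel = blahut_step PX dist lam Q.
Proof. by []. Qed.

Definition free_energy : \bar R := \int[PX]_x (- ln (Z x))%:E.

Lemma free_energy_ge0 : 0 <= free_energy.
Proof. by apply: integral_EFin_ge0 => x; exact: oppr_ln_partfun_ge0. Qed.

Lemma free_energy_le K : free_energy <= lagrangian Q K.
Proof.
have := conditional_donsker_varadhan PX K Q measurable_energy
  (measurableT_comp measurable_oppr_ln_partfun measurable_fst)
  energy_ge0 (fun x _ => oppr_ln_partfun_ge0 x).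
rewrite joint_expectation_fst [X in _ + (X + _)](_ : _ = 1).
  by rewrite (addeC 1) addeA -lagrangianE leeD2rE.
rewrite -[RHS](probability_integral_cst PX 1); apply: eq_integral => x _.
by rewrite -[RHS](integral_tilt x); apply: eq_integral => y _; rewrite tiltE.
Qed.

Lemma lagrangian_blahut_kernel : lagrangian Q blahut_kernel = free_energy.
Proof.
rewrite lagrangianE /condrelent /joint_expectation.
rewrite -lower_integralD; last 3 first.
- by move=> x; exact: (relent_ge0 (pker_law blahut_kernel x)).
- by move=> x; exact: integral_EFin_ge0.
- exact: measurable_pker_integral.
apply: eq_integral => x _; set P : probability TY R := pker_law blahut_kernel x.
have PQ : is_density P Q (fun y => expR (- ln (Z x) - energy x y)).
  under eq_fun do rewrite -tiltE.
  exact: (is_density_density_pker measurable_tilt tilt_ge0 integral_tilt).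
have := relent_chain_rule P (measurable_fun_pair2 x measurable_energy)
  (measurable_cst _) (energy_ge0 x) (fun=> oppr_ln_partfun_ge0 x) PQ.
by rewrite relent_refl add0e probability_integral_cst.
Qed.

Lemma blahut_log_density : exists g : TY -> R,
  [/\ measurable_fun [set: TY] g,
      is_density (marginal PX blahut_kernel) Q (expR \o g) &
      {ae Q, forall y, \int[PX]_x (tilt x y)%:E = (expR (g y))%:E}].
Proof.
apply: exists_log_density.
- apply: (@measurable_fun_fubini_tonelli_G _ _ _ _ _ PX
    (fun p => (tilt p.1 p.2)%:E)).
  + by apply/measurable_EFinP; exact: measurable_tilt.
  + by move=> p; rewrite lee_fin tilt_ge0.
- move=> y; apply: probability_integral_gt0 => [|x].
    exact: (measurable_fun_pair1 y measurable_tilt).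
  by rewrite tiltE expR_gt0.
- by move=> B mB; exact: marginal_density_pker.
Qed.

Lemma lagrangian_marginal_blahut_kernel_le :
  lagrangian (marginal PX blahut_kernel) blahut_kernel <= free_energy.
Proof.
have [g [mg Q'Q _]] := blahut_log_density.
rewrite -lagrangian_blahut_kernel /lagrangian (compensation_identity mg Q'Q).
by rewrite leeD2r// leeDl// relent_ge0.
Qed.

Section comparison.
Variables (K : R.-pker TX ~> TY) (g : TY -> R).
Hypothesis mg : measurable_fun [set: TY] g.
Hypothesis Q'Q : is_density (marginal PX blahut_kernel) Q (expR \o g).
Hypothesis g_ae : {ae Q, forall y, \int[PX]_x (tilt x y)%:E = (expR (g y))%:E}.
Local Notation P := (marginal PX K).

(* The test function is [ln (tilt x y) - g y], the log-density of the Blahut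
   kernel with respect to its own marginal. *)
Lemma free_energy_comparison h : is_density P Q h ->
  free_energy + \int[P]_y (g^\- y)%R%:E <=
  lagrangian P K + \int[P]_y (g^\+ y)%R%:E.
Proof.
move=> Ph; have mgp := measurable_funrpos mg; have mgn := measurable_funrneg mg.
have mZ1 := measurableT_comp measurable_oppr_ln_partfun
  (@measurable_fst _ _ TX TY).
have mgp2 := measurableT_comp mgp (@measurable_snd _ _ TX TY).
have mgn2 := measurableT_comp mgn (@measurable_snd _ _ TX TY).
have gp0 (x : TX) := funrpos_ge0 g; have gn0 (x : TX) := funrneg_ge0 g.
have Z0 x (y : TY) := oppr_ln_partfun_ge0 x.
have := conditional_donsker_varadhan PX K P
  (measurable_funD measurable_energy mgp2) (measurable_funD mZ1 mgn2)
  (fun x y => addr_ge0 (energy_ge0 x y) (gp0 x y))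
  (fun x y => addr_ge0 (Z0 x y) (gn0 x y)).
rewrite (joint_expectationD PX K measurable_energy mgp2 energy_ge0 gp0).
rewrite (joint_expectationD PX K mZ1 mgn2 Z0 gn0).
rewrite joint_expectation_fst !joint_expectation_snd//.
rewrite [X in _ + (X + _)](_ : _ = 1); last first.
  rewrite -(joint_expectation_density_ratio
    measurable_tilt tilt_ge0 mg Ph g_ae).
  apply: eq_integral => x _; apply: eq_integral => y _; congr (_%:E).
  rewrite tiltE -expRD; congr expR; rewrite -(funrposBnegE g y); ring.
rewrite (addeC 1) [X in _ <= X -> _]addeA leeD2rE//.
by rewrite [X in _ <= X -> _]addeA -lagrangianE.
Qed.

Lemma relent_blahut_step_le :
  relent P (marginal PX blahut_kernel) + free_energy <=
  lagrangian P K + relent P Q.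
Proof.
have [PQ_lty|] := ltP (relent P Q) +oo; last first.
  rewrite leye_eq => /eqP ->; rewrite addey ?leey// gt_eqF//.
  exact: lt_le_trans (lagrangian_ge0 P K).
have [h Ph] := relent_lty_density PQ_lty.
have gp_fin : \int[P]_y (g^\+ y)%R%:E \is a fin_num.
  rewrite ge0_fin_numE ?integral_EFin_ge0//.
  apply: le_lt_trans (integral_log_density_pos_le P mg Q'Q) _.
  by rewrite lte_add_pinfty// ltry.
rewrite -(leeD2rE _ _ gp_fin) addeAC (relent_chain_rule_log_density P mg Q'Q).
rewrite -addeA [X in _ + X <= _]addeC (addeC (lagrangian _ _)) -[leRHS]addeA.
by rewrite leeD2l// (free_energy_comparison Ph).
Qed.

End comparison.
End partition_function.
End blahut_single_step.

Lemma telescope_rate (R : realFieldType) (F : R) (f D : nat -> R) :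
    (forall k, 0 <= D k)%R -> (forall k, f k.+1 <= f k)%R ->
    (forall k, D k.+1 + f k <= F + D k)%R ->
  forall k, (f k <= F + D 0%N / k.+1%:R)%R.
Proof.
move=> D_ge0 f_dec step k.
have sum_le : (D k.+1 + k.+1%:R * f k <= k.+1%:R * F + D 0%N)%R.
  elim: k => [|k IH]; first by rewrite !mul1r.
  have : (k.+1%:R * f k.+1 <= k.+1%:R * f k)%R by rewrite ler_wpM2l.
  by have := step k.+1; rewrite -(natr1 k.+1) !mulrDl !mul1r; lra.
rewrite -lerBlDl ler_pdivlMr ?ltr0n// mulrBl ![(_ * k.+1%:R)%R]mulrC.
by have := D_ge0 k.+1; lra.
Qed.

Lemma telescope_rate_ereal (R : realType) (F : \bar R) (f D : nat -> \bar R) :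
    0 <= F -> D 0%N < +oo -> (forall k, 0 <= D k) -> (forall k, 0 <= f k) ->
    (forall k, f k.+1 <= f k) -> (forall k, D k.+1 + f k <= F + D k) ->
  forall k, f k <= F + D 0%N * (k.+1%:R^-1)%:E.
Proof.
move=> F_ge0 D0_lty D_ge0 f_ge0 f_dec step k.
have [F_lty|] := ltP F +oo; last first.
  rewrite leye_eq => /eqP ->; rewrite addye ?leey// gt_eqF//.
  by rewrite (@lt_le_trans _ _ 0)// mule_ge0// lee_fin invr_ge0.
have D_lty i : D i < +oo.
  elim: i => // i IH; apply: le_lt_trans (lte_add_pinfty F_lty IH).
  by apply: le_trans (step i); rewrite leeDl.
have f_lty i : f i < +oo.
  apply: le_lt_trans (lte_add_pinfty F_lty (D_lty i)).
  by apply: le_trans (step i); rewrite leeDr.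
have fE i : f i = (fine (f i))%:E by rewrite fineK// ge0_fin_numE.
have DE i : D i = (fine (D i))%:E by rewrite fineK// ge0_fin_numE.
have FE : F = (fine F)%:E by rewrite fineK// ge0_fin_numE.
rewrite fE DE FE -EFinM -EFinD lee_fin.
apply: (telescope_rate (f := fine \o f) (D := fine \o D)) => i /=.
- exact: fine_ge0.
- by rewrite -lee_fin -!fE.
- by rewrite -lee_fin !EFinD -!DE -fE -FE.
Qed.

Lemma cvg_harmonic_rate (R : realType) (F D : \bar R) (f : nat -> \bar R) :
    D \is a fin_num -> (forall k, F <= f k) ->
    (forall k, f k <= F + D * (k.+1%:R^-1)%:E) ->
  f k @[k --> \oo] --> F.
Proof.
move=> Dfin f_ge f_le.
apply: (squeeze_cvge (f := fun=> F) (h := fun k => F + D * (k.+1%:R^-1)%:E)).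
- by apply: nearW => k; rewrite f_ge f_le.
- exact: cvg_cst.
- rewrite -[X in _ --> X]adde0 -[X in _ --> _ + X](mule0 D).
  apply: cvgeD; [by rewrite mule0 fin_num_adde_defl|exact: cvg_cst|].
  by apply: cvgeZl => //; exact: cvge_harmonic.
Qed.

Section blahut_iteration.
Context (R : realType) (dx dy : measure_display).
Context (TX : measurableType dx) (TY : measurableType dy).
Variables (PX : probability TX R) (dist : TX -> TY -> R) (lam : R).
Variable PY0 : probability TY R.
Hypothesis mdist : measurable_fun [set: TX * TY] (fun p => dist p.1 p.2).
Hypothesis dist_ge0 : forall x y, (0 <= dist x y)%R.
Hypothesis lam_ge0 : (0 <= lam)%R.
Implicit Type K : R.-pker TX ~> TY.

Fixpoint blahut_law (k : nat) : probability TY R :=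
  if k is k'.+1
  then marginal PX (blahut_kernel mdist dist_ge0 lam_ge0 (blahut_law k'))
  else PY0.

Lemma blahut_lawE k :
  blahut_law k = blahut PX dist lam PY0 k :> (set TY -> \bar R).
Proof. by elim: k => //= k <-; exact: marginal_blahut_kernel. Qed.

Lemma Fk_le_lagrangian K k :
  Fk PX dist lam PY0 k.+1 <= lagrangian PX dist lam (blahut_law k) K.
Proof. by rewrite blahut_lawE; apply: ereal_inf_lbound; exists K. Qed.

Lemma RDF_le_lagrangian K :
  RDF PX dist lam <= lagrangian PX dist lam (marginal PX K) K.
Proof. by apply: ereal_inf_lbound; exists K. Qed.

Lemma Fk_free_energy k :
  Fk PX dist lam PY0 k.+1 = free_energy PX dist lam (blahut_law k).
Proof.
apply/eqP; rewrite eq_le; apply/andP; split.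
- rewrite -(lagrangian_blahut_kernel PX mdist dist_ge0 lam_ge0).
  exact: Fk_le_lagrangian.
- apply: le_ereal_inf_tmp => _ [K _ <-]; rewrite /= -blahut_lawE.
  exact: (free_energy_le PX mdist dist_ge0 lam_ge0).
Qed.

Lemma Fk_ge0 k : 0 <= Fk PX dist lam PY0 k.+1.
Proof. by rewrite Fk_free_energy free_energy_ge0. Qed.

Lemma RDF_le_Fk k : RDF PX dist lam <= Fk PX dist lam PY0 k.+1.
Proof.
rewrite Fk_free_energy; apply: le_trans (RDF_le_lagrangian _) _.
exact: lagrangian_marginal_blahut_kernel_le.
Qed.

Lemma Fk_nonincreasing k : Fk PX dist lam PY0 k.+2 <= Fk PX dist lam PY0 k.+1.
Proof.
rewrite [leRHS]Fk_free_energy; apply: le_trans (Fk_le_lagrangian _ _) _.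
exact: lagrangian_marginal_blahut_kernel_le.
Qed.

Lemma Fk_rate K k : relent (marginal PX K) PY0 < +oo ->
  Fk PX dist lam PY0 k.+1 <= mutinf PX K + lam%:E * exp_distortion PX dist K +
    relent (marginal PX K) PY0 * (k.+1%:R^-1)%:E.
Proof.
move=> relent_lty; apply: (telescope_rate_ereal
  (f := fun k => Fk PX dist lam PY0 k.+1)
  (D := fun k => relent (marginal PX K) (blahut_law k))).
- exact: (lagrangian_ge0 PX mdist dist_ge0 lam_ge0 (marginal PX K)).
- exact: relent_lty.
- by move=> i; exact: relent_ge0.
- exact: Fk_ge0.
- exact: Fk_nonincreasing.
- move=> i; rewrite Fk_free_energy.
  have [g [mg Q'Q g_ae]] :=
    blahut_log_density PX mdist dist_ge0 lam_ge0 (blahut_law i).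
  exact: relent_blahut_step_le mg Q'Q g_ae.
Qed.

End blahut_iteration.

Theorem theorem6 (R : realType) (dx dy : measure_display)
  (TX : measurableType dx) (TY : measurableType dy)
  (PX : probability TX R) (dist : TX -> TY -> R) (lam : R)
  (Kstar : R.-pker TX ~> TY) (PY0 : probability TY R) :
  (forall x : TX, measurable [set x]) ->
  (forall y : TY, measurable [set y]) ->
  measurable_fun [set: TX * TY] (fun p => dist p.1 p.2) ->
  (forall x y, 0 <= dist x y)%R ->
  (0 < lam)%R ->
  mutinf PX Kstar + lam%:E * exp_distortion PX dist Kstar = RDF PX dist lam ->
  relent (marginal PX Kstar) PY0 < +oo ->
  [/\ (forall k, (1 <= k)%N -> Fk PX dist lam PY0 k.+1 <= Fk PX dist lam PY0 k),
      Fk PX dist lam PY0 k @[k --> \oo] --> RDF PX dist lam &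
      (forall k, (1 <= k)%N ->
         Fk PX dist lam PY0 k
           <= RDF PX dist lam + relent (marginal PX Kstar) PY0 * (k%:R^-1)%:E)].
Proof.
move=> _ _ mdist dist_ge0 /ltW lam_ge0 Kstar_opt relent_lty.
have rate k := Fk_rate mdist dist_ge0 lam_ge0 k relent_lty.
rewrite Kstar_opt in rate; split.
- move=> k /prednK <-; exact: (Fk_nonincreasing PX PY0 mdist dist_ge0 lam_ge0).
- rewrite -(cvg_shiftS (fun k => Fk PX dist lam PY0 k)).
  apply: cvg_harmonic_rate rate; first by rewrite ge0_fin_numE ?relent_ge0.
  exact: (RDF_le_Fk PX PY0 mdist dist_ge0 lam_ge0).
- move=> k /prednK <-; exact: rate.
Qed.
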